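(* Fix $\alpha\in(1,\tfrac32]$ and a constant $c>0$. Let $A\subset[1,2]$ be a finite set which is $\sim|A|^{-1}$-separated, i.e. $|a-a'|\ge c|A|^{-1}$ for all distinct $a,a'\in A$, and let $\delta=|A|^{-\alpha}$. Then for every $\epsilon>0$, $$\mathcal{N}(A+A,\delta)\cdot\mathcal{N}(AA,\delta)\gtrsim_{\epsilon}|A|\,\delta^{-1+\epsilon}=|A|^{1+\alpha-\epsilon'},\qquad \epsilon'=\epsilon\alpha,$$ and consequently $$\max\{\mathcal{N}(A+A,\delta),\mathcal{N}(AA,\delta)\}\gtrsim_{\epsilon}\delta^{-1/2+\epsilon}|A|^{1/2}=|A|^{\frac{1+\alpha}{2}-\epsilon'}.$$ The implicit constants depend only on $\epsilon$ (and the fixed $\alpha$, $c$), not on $A$.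
   Context: $A+A=\{a+a':a,a'\in A\}$ and $AA=\{aa':a,a'\in A\}$. For $B\subset\mathbb{R}$ and $\delta>0$, $\mathcal{N}(B,\delta)$ denotes the maximal cardinality of a $\delta$-separated subset of $B$. $X\gtrsim_\epsilon Y$ means $X\ge C_\epsilon^{-1} Y$ for a constant $C_\epsilon$ depending on $\epsilon$. *)

(* Defs.v *)
From HB Require Import structures.
From mathcomp Require Import all_boot all_order all_algebra finmap.
From mathcomp Require Import all_classical all_reals all_analysis.

Set Implicit Arguments.
Unset Strict Implicit.
Unset Printing Implicit Defensive.

Import Order.TTheory GRing.Theory Num.Theory.

Local Open Scope fset_scope.
Local Open Scope ring_scope.

Section SumsetsAndSeparation.
Variable R : realType.
Implicit Types (A B S : {fset R}) (r : R).

Definition sumset A : {fset R} := [fset a + a' | a in A, a' in A].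

Definition prodset A : {fset R} := [fset a * a' | a in A, a' in A].

Definition dist_separated r S : Prop :=
  forall x y : R, x \in S -> y \in S -> x != y -> r <= `|x - y|.

(* Subsets of a finite [B] only, so that the maximum is attained: this is used
   just for the sum set and the product set of a finite set. *)
Definition sepnum B r : nat :=
  \max_(S <- fpowerset B | `[< dist_separated r S >]) #|` S|.

End SumsetsAndSeparation.

(* Main.v *)
(* Let X be the product of the two covering numbers. The |A|^2 lines
   y = a (x - b) each meet |A| of the X boxes of side delta formed by maximal
   separated subsets of A + A and AA, namely at (b + a', a a'). Compare the
   delta-strip T around a line with the strip T' of width about 1/|A| around
   it: h_T = 1_T - (|T|/|T'|) 1_T'. For each slope the fat strips are
   disjoint, so the averaged richness is at most about |A|^2 delta everywhere.
   In the L^2 norm, strips of equal slope are orthogonal by disjointness, and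
   transversal ones because h_T has mean zero across its strip, except when the
   crossing is cut by the boundary of the window; these exceptions contribute a
   harmonic sum that is absorbed because alpha > 1. Hence sum_T h_T has squared
   norm at most about |A|^2 delta, and Cauchy-Schwarz gives
   X >~ min(|A| / delta, |A|^4 delta), which is |A| / delta for alpha <= 3/2;
   no epsilon is lost.

   Everything is discretized on integer points with integer slopes and with
   strip widths divisible by all differences of slopes, which makes the
   orthogonality exact and all integrals finite sums. *)
Require Import Defs.
From HB Require Import structures.
From mathcomp Require Import all_boot all_order all_algebra finmap.
From mathcomp Require Import all_classical all_reals all_analysis.
From mathcomp Require Import zify ring lra.

Set Implicit Arguments.
Unset Strict Implicit.
Unset Printing Implicit Defensive.

Import Order.TTheory GRing.Theory Num.Theory.

Local Open Scope fset_scope.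
Local Open Scope ring_scope.

(** * Terms of arithmetic progressions in integer windows *)

Lemma sum_atmost1 (R : numDomainType) (I : finType) (P : pred I) :
  (forall x y, P x -> P y -> x = y) -> \sum_x (P x)%:R <= 1 :> R.
Proof.
move=> Pinj; case: (pickP P) => [x Px|P0]; last first.
  by rewrite big1 // => x _; rewrite P0.
rewrite (bigD1 x) //= Px big1 ?addr0 // => y yx.
by case Py: (P y) => //; rewrite (Pinj y x) ?eqxx in yx.
Qed.

Section Kernel.
Variable R : realFieldType.

Definition ind (E : nat) (z : int) : R := ((0 <= z) && (z < E%:Z))%:R.

Lemma indD E E' z : ind (E + E') z = ind E z + ind E' (z - E%:Z).
Proof.
rewrite /ind -natrD; congr (_%:R).
by case: (leP 0 z); case: (ltP z E%:Z); case: (leP 0 (z - E%:Z));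
  case: (ltP z (E + E')%:Z); case: (ltP (z - E%:Z) E'%:Z) => //=; lia.
Qed.

Lemma ind_ge0 E z : 0 <= ind E z.
Proof. exact: ler0n. Qed.

Lemma ind_out E z : ~ (0 <= z < E%:Z) -> ind E z = 0.
Proof. by rewrite /ind; case: andP => // -[-> ->]. Qed.

Lemma ind_in E z : 0 <= z < E%:Z -> ind E z = 1.
Proof. by rewrite /ind => ->. Qed.

(** A window of length [E = h d] splits into [h] windows of length [d], and each of these catches at
    most one term of a progression of step [d]. *)
Lemma progression_count_le (d E L : nat) (t : int) : (0 < d)%N -> (d %| E)%N ->
  \sum_(x < L) ind E (d%:Z * x%:Z - t) <= (E %/ d)%:R.
Proof.
move=> d0 /dvdnP[h ->]; rewrite mulnK //; elim: h t => [|h IH] t.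
  by rewrite big1 // => x _; rewrite ind_out //; lia.
rewrite mulSn.
under eq_bigr do rewrite indD -addrA -opprD.
rewrite big_split /= -natr1 addrC lerD //.
by apply: sum_atmost1 => x y hx hy; apply/ord_inj; nia.
Qed.

Lemma progression_count (d E L t : nat) : (0 < d)%N -> (d %| E)%N ->
  (t + E <= d * L)%N ->
  \sum_(x < L) ind E (d%:Z * x%:Z - t%:Z) = (E %/ d)%:R.
Proof.
move=> d0 /dvdnP[h ->]; rewrite mulnK //; elim: h t => [|h IH] t tL.
  by rewrite big1 // => x _; rewrite ind_out //; lia.
rewrite mulSn.
under eq_bigr do rewrite indD -addrA -opprD -PoszD.
rewrite big_split /= IH ?[RHS]mulrSr; last by rewrite -addnA -mulSn.
rewrite addrC; congr (_ + _).
(* The quotient is the ceiling of [t / d], the index of the term in the first window; it stays below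
   [L] because [t + d <= d L]. *)
have tE : ((t + d.-1) = (t + d.-1) %/ d * d + (t + d.-1) %% d)%N by exact: divn_eq.
have tm : ((t + d.-1) %% d < d)%N by rewrite ltn_mod.
have xL : ((t + d.-1) %/ d < L)%N by nia.
apply/eqP; rewrite eq_le sum_atmost1 => [/=|x y hx hy]; last by apply/ord_inj; nia.
rewrite (bigD1 (Ordinal xL)) //= ind_in; last by nia.
by rewrite lerDl sumr_ge0 // => *; rewrite ind_ge0.
Qed.

(* A thin strip minus its fattening: q * D is the width of the fat strip, and
   the weights make the total mass vanish. *)
Definition profile (q D : nat) (z : int) : R := q%:R * ind D z - ind (q * D) z.

Lemma profile_out q D z : (0 < q)%N -> ~ (0 <= z < (q * D)%:Z) -> profile q D z = 0.
Proof.
move=> q0 hz; rewrite /profile (ind_out hz) ind_out ?mulr0 ?subr0 //.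
by move: hz; nia.
Qed.

(** A progression of step [d] has [D / d] terms in the thin window and [q D / d] in the fat one, so
    the weight [q] cancels them exactly. This can fail only if an end of the progression cuts the
    fat window. *)
Lemma profile_sum_eq0 (q D d L : nat) (t : int) : (0 < d)%N -> (0 < q)%N -> (d %| D)%N ->
  (forall x : nat, (x < L)%N -> ~ (0 <= d%:Z * x%:Z - t < (q * D)%:Z)) \/
  (0 <= t /\ t + (q * D)%:Z <= (d * L)%:Z) ->
  \sum_(x < L) profile q D (d%:Z * x%:Z - t) = 0.
Proof.
move=> d0 q0 dD [out|[]].
  by rewrite big1 // => x _; rewrite profile_out //; apply: out.
case: t => // t _ tL; rewrite sumrB -mulr_sumr.
have DW : (D <= q * D)%N by rewrite leq_pmull.
rewrite !progression_count ?dvdn_mull //; try by lia.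
by rewrite -natrM muln_divA // subrr.
Qed.

(** Valid for cut windows too: the weighted thin count and the fat count both lie between 0 and
    [q D / d]. *)
Lemma profile_sum_le (q D d L : nat) (t : int) : (0 < d)%N -> (d %| D)%N ->
  `|\sum_(x < L) profile q D (d%:Z * x%:Z - t)| <= (q * D %/ d)%:R.
Proof.
move=> d0 dD; rewrite sumrB -mulr_sumr.
have h1 := progression_count_le L t d0 dD.
have h2 := progression_count_le L t d0 (dvdn_mull q dD).
have h10 : 0 <= \sum_(x < L) ind D (d%:Z * x%:Z - t) by apply: sumr_ge0 => *; apply: ind_ge0.
have h20 : 0 <= \sum_(x < L) ind (q * D) (d%:Z * x%:Z - t) by apply: sumr_ge0 => *; apply: ind_ge0.
have h3 : q%:R * \sum_(x < L) ind D (d%:Z * x%:Z - t) <= (q * D %/ d)%:R.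
  by rewrite -muln_divA // natrM ler_wpM2l.
have h4 : 0 <= q%:R * \sum_(x < L) ind D (d%:Z * x%:Z - t) by rewrite mulr_ge0.
by rewrite ler_norml; lra.
Qed.

Lemma sum_ind (E W : nat) : (E <= W)%N -> \sum_(v < W) ind E v%:Z = E%:R.
Proof.
move=> EW; have := @progression_count 1 E W 0 isT (dvd1n _).
rewrite add0n mul1n divn1 => <- //.
by apply: eq_bigr => v _; rewrite mul1r subr0.
Qed.

Lemma sum_norm_profile (q D : nat) : (0 < q)%N ->
  \sum_(v < q * D) `|profile q D v%:Z| <= 2 * (q * D)%:R.
Proof.
move=> q0; apply: le_trans (_ : \sum_(v < q * D) (q%:R * ind D v%:Z + ind (q * D) v%:Z) <= _).
  apply: ler_sum => v _; apply: le_trans (ler_normB _ _) _.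
  by rewrite normrM !ger0_norm ?ind_ge0.
by rewrite big_split -mulr_sumr /= !sum_ind ?leq_pmull // -natrM mulr_natl mulr2n.
Qed.

Lemma sum_sqr_profile (q D : nat) : (0 < q)%N ->
  \sum_(v < q * D) profile q D v%:Z ^+ 2 <= 2 * q%:R ^+ 2 * D%:R.
Proof.
move=> q0; apply: le_trans (_ : \sum_(v < q * D) (q%:R ^+ 2 * ind D v%:Z + ind (q * D) v%:Z) <= _).
  apply: ler_sum => v _; rewrite /profile /ind.
  have : 1 <= q%:R :> R by rewrite ler1n.
  by case: (_ && _); case: (_ && _) => /=; nra.
rewrite big_split -mulr_sumr /= !sum_ind ?leq_pmull // natrM.
have q1 : q%:R <= q%:R ^+ 2 :> R by rewrite -natrX ler_nat leq_pmull.
have D0 : 0 <= D%:R :> R by [].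
have := ler_wpM2r D0 q1; lra.
Qed.

Lemma shift_sum (phi : int -> R) (W N : nat) (u : int) :
  (forall z, ~ (0 <= z < W%:Z) -> phi z = 0) -> 0 <= u -> u + W%:Z <= N%:Z ->
  \sum_(y < N) phi (y%:Z - u) = \sum_(v < W) phi v%:Z.
Proof.
case: u => // u phi0 _ uN.
have -> : N = (u + (W + (N - u - W)))%N by lia.
rewrite !big_split_ord /= big1 => [|y _]; last by rewrite phi0 //; have := ltn_ord y; lia.
rewrite [X in _ + (_ + X)]big1 => [|y _]; last by rewrite phi0 //=; lia.
by rewrite add0r addr0; apply: eq_bigr => v _; congr phi => /=; lia.
Qed.

End Kernel.

Lemma sum_inj_le (R : numDomainType) (K T : finType) (g : K -> T) (h : T -> R) :
  injective g -> (forall t, 0 <= h t) -> \sum_k h (g k) <= \sum_t h t.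
Proof.
move=> g_inj h0.
rewrite -(big_map g xpredT h) big_uniq /=; last first.
  by rewrite map_inj_uniq // index_enum_uniq.
by rewrite [leRHS](bigID (mem (map g (index_enum K)))) /= lerDl sumr_ge0.
Qed.

(** Cauchy-Schwarz against the constant function, read off from the nonnegative sum of
    [(#|K| h k - s)^2]. *)
Lemma sqr_sum_le (R : realFieldType) (K : finType) (h : K -> R) :
  (\sum_k h k) ^+ 2 <= #|K|%:R * \sum_k h k ^+ 2.
Proof.
set s := \sum_k h k; set t := \sum_k _.
have [K0|K0] := posnP #|K|.
  by rewrite /s big1 ?expr0n ?K0 ?mul0r // => k; have := card0_eq K0 k; rewrite inE.
have K1 : 0 < #|K|%:R :> R by rewrite ltr0n.
have : 0 <= \sum_k (#|K|%:R * h k - s) ^+ 2 by apply: sumr_ge0 => k _; apply: sqr_ge0.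
have E k : (#|K|%:R * h k - s) ^+ 2 =
    #|K|%:R ^+ 2 * h k ^+ 2 - 2 * #|K|%:R * s * h k + s ^+ 2 by ring.
under eq_bigr do rewrite E.
rewrite big_split sumrB /= -!mulr_sumr sumr_const -[_ *+ #|_|]mulr_natl -/s -/t => h0.
rewrite -(ler_pM2l K1); lra.
Qed.

(** * Correlations of strip profiles *)

Section Variance.
Variables (R : realFieldType) (L N D q : nat).
Hypotheses (q_gt0 : (0 < q)%N).

Local Notation W := (q * D)%N.

(** The fat strip resting on [y = m x - c] never leaves the window through its top or bottom, so
    that only the sides [x = 0] and [x = L] can cut a crossing. *)
Definition fits (m c : int) :=
  forall x : nat, (x < L)%N -> 0 <= m * x%:Z - c /\ m * x%:Z - c + W%:Z <= N%:Z.

Definition corr (m c m' c' : int) : R :=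
  \sum_(x < L) \sum_(y < N)
    profile R q D (y%:Z - (m * x%:Z - c)) * profile R q D (y%:Z - (m' * x%:Z - c')).

Lemma corrC m c m' c' : corr m c m' c' = corr m' c' m c.
Proof. by apply: eq_bigr => x _; apply: eq_bigr => y _; rewrite mulrC. Qed.

(** Let [v = y - (m x - c)] be the height inside the first strip; by [fits] it takes all values
    below [W] in every column. For fixed [v] the second profile is sampled along a progression of
    step [m - m']. *)
Lemma corrE m c m' c' : fits m c ->
  corr m c m' c' = \sum_(v < W) profile R q D v%:Z *
     \sum_(x < L) profile R q D (v%:Z + (m - m') * x%:Z - (c - c')).
Proof.
move=> fit; under [RHS]eq_bigr do rewrite mulr_sumr.
rewrite exchange_big; apply: eq_bigr => x _ /=.
have [u0 uN] := fit x (ltn_ord x).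
rewrite -(@shift_sum R (fun z => profile R q D z * profile R q D (z + (m - m') * x%:Z - (c - c')))
  W N _ _ u0 uN) => [|z hz]; last by rewrite profile_out ?mul0r.
by apply: eq_bigr => y _; congr (_ * profile _ _ _ _); lia.
Qed.

Lemma corr_self m c : fits m c -> corr m c m c <= 2 * q%:R ^+ 2 * D%:R * L%:R.
Proof.
move=> fit; rewrite corrE //.
under eq_bigr => v _.
  under eq_bigr do rewrite !subrr mul0r subr0 addr0.
  rewrite sumr_const card_ord -mulr_natr mulrA -expr2; over.
by rewrite -mulr_suml ler_wpM2r // sum_sqr_profile.
Qed.

(** The two fat strips are disjoint in every column. *)
Lemma corr_parallel m c c' : W%:Z <= `|c - c'| -> corr m c m c' = 0.
Proof.
move=> cc; rewrite /corr big1 // => x _; rewrite big1 // => y _.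
case: (boolP (0 <= y%:Z - (m * x%:Z - c) < W%:Z)) => h; last first.
  by rewrite (profile_out _ q_gt0 (elimN idP h)) mul0r.
by rewrite mulrC profile_out ?mul0r //; lia.
Qed.

(* As d divides D, the two mean-zero profiles are exactly orthogonal unless the
   crossing of the fat strips is cut by one of the sides x = 0, x = L. *)
Lemma corr_transversal_pos m c m' c' (d : nat) : m - m' = d%:Z -> (0 < d)%N -> (d %| D)%N ->
  fits m c -> corr m c m' c' <= 2 * W%:R ^+ 2 / d%:R *
    ((`|c - c'| < W%:Z)%R%:R + (`|(m - m') * L%:Z - (c - c')| < W%:Z)%R%:R).
Proof.
move=> md d0 dD fit; rewrite corrE // md; set e := c - c'.
have E v : \sum_(x < L) profile R q D (v%:Z + d%:Z * x%:Z - e) =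
    \sum_(x < L) profile R q D (d%:Z * x%:Z - (e - v%:Z)).
  by apply: eq_bigr => x _; congr (profile _ _ _ _); lia.
under eq_bigr do rewrite E.
(* A cut at [x = 0] forces [|e| < W], one at [x = L] forces [|d L - e| < W]. Then absolute values
   suffice: the profile has absolute mass at most [2 W], and each inner sum is at most [W / d]. *)
case: (boolP ((`|e| < W%:Z) || (`|d%:Z * L%:Z - e| < W%:Z))) => [hb|].
  apply: le_trans (_ : 2 * W%:R ^+ 2 / d%:R * 1 <= _); last first.
    rewrite ler_wpM2l ?divr_ge0 ?mulr_ge0 ?exprn_ge0 //.
    by case/orP: hb => ->; rewrite ?lerDl ?lerDr.
  rewrite mulr1; apply: le_trans (ler_norm _) _.
  apply: le_trans (ler_norm_sum _ _ _) _.
  have dW : W%:R / d%:R = (W %/ d)%:R :> R.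
    have /dvdnP[h ->] : (d %| W)%N by rewrite dvdn_mull.
    by rewrite mulnK // natrM mulfK // pnatr_eq0 -lt0n.
  have -> : 2 * W%:R ^+ 2 / d%:R = 2 * W%:R * (W %/ d)%:R :> R.
    by rewrite -dW expr2 !mulrA.
  apply: le_trans (ler_wpM2r _ (@sum_norm_profile R q D q_gt0)) => //.
  rewrite mulr_suml; apply: ler_sum => v _; rewrite normrM ler_wpM2l //.
  exact: profile_sum_le.
rewrite negb_or => /andP[h1 h2].
rewrite big1 ?mulr_ge0 ?divr_ge0 ?exprn_ge0 ?addr_ge0 // => v _.
rewrite profile_sum_eq0 ?mulr0 //.
have vW := ltn_ord v.
(* Without a cut, either the windows of all [v] lie inside the range of the progression, or all of
   them miss it. *)
case: (boolP ((W%:Z <= e) && (W%:Z <= d%:Z * L%:Z - e))) => [h|h]; first by right; lia.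
left=> x xL hx.
have dx : (d * x <= d * L)%N by rewrite leq_pmul2l // ltnW.
move: h h1 h2 hx dx; rewrite -!PoszM; lia.
Qed.

(** Symmetry of [corr] allows the larger slope to come first. *)
Lemma corr_transversal m c m' c' : m != m' -> (`|m - m'| %| D)%N ->
  fits m c -> fits m' c' -> corr m c m' c' <= 2 * W%:R ^+ 2 / (`|m - m'|%N)%:R *
    ((`|c - c'| < W%:Z)%R%:R + (`|(m - m') * L%:Z - (c - c')| < W%:Z)%R%:R).
Proof.
move=> mm dD f f'; case: (ltgtP m m') mm => // mm _.
  have eL : `|(m - m') * L%:Z - (c - c')| = `|(m' - m) * L%:Z - (c' - c)|.
    by rewrite -normrN; congr (Num.norm _); ring.
  rewrite corrC distrC eL; apply: corr_transversal_pos => //; lia.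
by apply: corr_transversal_pos => //; lia.
Qed.

(** * Families of strips with several slopes *)

Section Family.
Variables (I J : finType) (m : I -> int) (c : I -> J -> int).
Hypothesis fit : forall i j, fits (m i) (c i j).
Hypothesis m_inj : injective m.
Hypothesis m_dvd : forall i i', i' != i -> (`|(m i - m i')|%N %| D)%N.
Hypothesis c_sep : forall i j j', j != j' -> W%:Z <= `|c i j - c i j'|.

Lemma sum_window_le1 i (z : int) :
  \sum_j ((0 <= c i j - z) && (c i j - z < W%:Z))%R%:R <= 1 :> R.
Proof.
apply: sum_atmost1 => j j' h h'; apply/eqP/negPn/negP => jj.
by have := c_sep i jj; lia.
Qed.

(** The open interval of radius [W] around [z] is covered by two adjacent windows of length [W],
    each holding at most one intercept. *)
Lemma sum_window_le2 i (z : int) : \sum_j (`|z - c i j| < W%:Z)%R%:R <= 2 :> R.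
Proof.
apply: le_trans (lerD (sum_window_le1 i z) (sum_window_le1 i (z - W%:Z))).
rewrite -big_split; apply: ler_sum => j _ /=; rewrite -natrD ler_nat.
by do 3 (case: (boolP (_ && _)) || case: (boolP (_ < _))); lia.
Qed.

(** Fat strips of one slope are disjoint, so each slope contributes at most 1. *)
Lemma fat_richness_le (x y : int) :
  \sum_i \sum_j ind R W (y - (m i * x - c i j)) <= #|I|%:R.
Proof.
rewrite -sum1_card natr_sum; apply: ler_sum => i _.
apply: le_trans (sum_window_le1 i (m i * x - y)).
by apply: ler_sum => j _; rewrite /ind ler_nat; case: (boolP (_ && _));
  case: (boolP (_ && _)); lia.
Qed.

Lemma sum_sqr_corr :
  \sum_(x < L) \sum_(y < N) (\sum_i \sum_j profile R q D (y%:Z - (m i * x%:Z - c i j))) ^+ 2 =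
  \sum_i \sum_j \sum_i' \sum_j' corr (m i) (c i j) (m i') (c i' j').
Proof.
pose k i j (x y : nat) := profile R q D (y%:Z - (m i * x%:Z - c i j)).
transitivity (\sum_(x < L) \sum_(y < N) \sum_i \sum_j \sum_i' \sum_j' k i j x y * k i' j' x y).
  apply: eq_bigr => x _; apply: eq_bigr => y _.
  rewrite expr2 mulr_suml; apply: eq_bigr => i _.
  rewrite mulr_suml; apply: eq_bigr => j _.
  by rewrite mulr_sumr; apply: eq_bigr => i' _; rewrite mulr_sumr.
rewrite pair_bigA exchange_big; apply: eq_bigr => i _ /=.
rewrite exchange_big; apply: eq_bigr => j _ /=.
rewrite exchange_big; apply: eq_bigr => i' _ /=.
rewrite exchange_big; apply: eq_bigr => j' _ /=.
by rewrite -(pair_bigA _ (fun x y : 'I__ => k i j x y * k i' j' x y)).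
Qed.

(** Among strips of the same slope only the strip itself contributes. For any other slope, at most
    two intercepts give a crossing cut at [x = 0] and at most two a crossing cut at [x = L], whence
    [8 = 2 * (2 + 2)]. *)
Lemma sum_corr_le i j :
  \sum_i' \sum_j' corr (m i) (c i j) (m i') (c i' j') <= 2 * q%:R ^+ 2 * D%:R * L%:R +
  8 * W%:R ^+ 2 * \sum_(i' | i' != i) (`|m i - m i'|%N)%:R^-1.
Proof.
rewrite (bigD1 i) //= lerD //.
  rewrite (bigD1 j) //= big1 ?addr0 ?corr_self // => j' jj.
  by apply: corr_parallel; apply: c_sep; rewrite eq_sym.
rewrite mulr_sumr; apply: ler_sum => i' ii.
have mm : m i != m i' by apply: contra ii => /eqP/m_inj->.
apply: le_trans (ler_sum _ (fun j' _ => corr_transversal mm (m_dvd ii) (fit i j) (fit i' j'))) _.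
rewrite -mulr_sumr big_split /=.
have e2 j' : `|(m i - m i') * L%:Z - (c i j - c i' j')| =
    `|(c i j - (m i - m i') * L%:Z) - c i' j'|.
  by rewrite -normrN; congr (Num.norm _); ring.
under [X in _ * (_ + X)]eq_bigr do rewrite e2.
have h1 := sum_window_le2 i' (c i j).
have h2 := sum_window_le2 i' (c i j - (m i - m i') * L%:Z).
apply: le_trans (ler_wpM2l _ (lerD h1 h2)) _; first by rewrite divr_ge0 ?mulr_ge0 ?exprn_ge0.
by rewrite le_eqVlt; apply/orP; left; apply/eqP; ring.
Qed.

Lemma high_variance :
  \sum_(x < L) \sum_(y < N) (\sum_i \sum_j profile R q D (y%:Z - (m i * x%:Z - c i j))) ^+ 2 <=
  #|I|%:R * #|J|%:R * (2 * q%:R ^+ 2 * D%:R * L%:R) +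
  8 * #|J|%:R * W%:R ^+ 2 * \sum_i \sum_(i' | i' != i) (`|m i - m i'|%N)%:R^-1.
Proof.
rewrite sum_sqr_corr; apply: le_trans (ler_sum _ (fun i _ => ler_sum _ (fun j _ => sum_corr_le i j))) _.
under eq_bigr do rewrite sumr_const -[_ *+ #|_|]mulr_natl mulrDr.
rewrite big_split /= sumr_const -!mulr_sumr -[_ *+ #|_|]mulr_natl.
by rewrite le_eqVlt; apply/orP; left; apply/eqP; ring.
Qed.

(** The fat strips account for at most [#|I| #|K|], which is at most half of [inc]. So the profiles
    still sum to at least [inc / 2] over the points [g k], and Cauchy-Schwarz with [high_variance]
    bounds the square; the factor 4 pays for the half. *)
Lemma incidence_bound (K : finType) (g : K -> 'I_L * 'I_N) : injective g ->
  let inc := q%:R * \sum_k \sum_i \sum_j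
    ind R D ((g k).2%:Z - (m i * (g k).1%:Z - c i j)) in
  2 * #|I|%:R * #|K|%:R <= inc ->
  inc ^+ 2 <= 4 * #|K|%:R * (#|I|%:R * #|J|%:R * (2 * q%:R ^+ 2 * D%:R * L%:R) +
  8 * #|J|%:R * W%:R ^+ 2 * \sum_i \sum_(i' | i' != i) (`|m i - m i'|%N)%:R^-1).
Proof.
move=> g_inj inc inc_ge.
pose h (p : 'I_L * 'I_N) := \sum_i \sum_j profile R q D (p.2%:Z - (m i * p.1%:Z - c i j)).
have hE : \sum_k h (g k) = inc - \sum_k \sum_i \sum_j
    ind R W ((g k).2%:Z - (m i * (g k).1%:Z - c i j)).
  rewrite /inc mulr_sumr -sumrB; apply: eq_bigr => k _.
  rewrite mulr_sumr -sumrB; apply: eq_bigr => i _.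
  by rewrite mulr_sumr -sumrB; apply: eq_bigr => j _.
have hge : inc <= 2 * \sum_k h (g k).
  have : \sum_k \sum_i \sum_j ind R W ((g k).2%:Z - (m i * (g k).1%:Z - c i j))
      <= #|I|%:R * #|K|%:R.
    apply: le_trans (ler_sum _ (fun k _ => fat_richness_le _ _)) _.
    by rewrite sumr_const -[_ *+ #|_|]mulr_natr.
  by rewrite hE; lra.
have inc0 : 0 <= inc by apply: le_trans inc_ge; rewrite !mulr_ge0.
have h2 : \sum_k h (g k) ^+ 2 <= \sum_(x < L) \sum_(y < N) h (x, y) ^+ 2.
  rewrite pair_bigA /=.
  apply: le_trans (sum_inj_le g_inj (fun p => sqr_ge0 (h p))) _.
  by rewrite (eq_bigr (fun p => h (p.1, p.2) ^+ 2)) // => -[].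
have cs := sqr_sum_le (fun k => h (g k)).
apply: le_trans (_ : 4 * (\sum_k h (g k)) ^+ 2 <= _); first by nra.
rewrite -!mulrA ler_pM2l //; apply: le_trans cs _; rewrite ler_wpM2l //.
by apply: le_trans h2 _; rewrite !mulrA -!mulrA; have := high_variance; rewrite -!mulrA.
Qed.

End Family.
End Variance.

(** * Harmonic sums *)

(** For each [i], every distance [k + 1] is attained by at most two indices [i'], one on either
    side. *)
Lemma sum_inv_dist_le (R : realFieldType) (n : nat) :
  \sum_(i < n) \sum_(i' < n | i' != i) (`|i%:R - i'%:R|)^-1 <=
  2 * n%:R * \sum_(k < n) k.+1%:R^-1 :> R.
Proof.
rewrite [2 * _]mulrC -[n in n%:R]card_ord -mulrA mulr_natl -sumr_const.
apply: ler_sum => i _.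
apply: le_trans (_ : \sum_(i' < n) \sum_(k < n)
  (((i : nat) == i' + k.+1)%N%:R + ((i' : nat) == i + k.+1)%N%:R) * k.+1%:R^-1 <= _).
  rewrite big_mkcond; apply: ler_sum => i' _.
  have nn (k : 'I_n) : 0 <= (((i : nat) == i' + k.+1)%N%:R + ((i' : nat) == i + k.+1)%N%:R) * k.+1%:R^-1 :> R.
    by rewrite mulr_ge0 ?addr_ge0 ?invr_ge0.
  case: ifP => [ii|_]; last exact: sumr_ge0.
  have kn : ((maxn i i' - minn i i').-1 < n)%N by have := ltn_ord i; have := ltn_ord i'; lia.
  rewrite (bigD1 (Ordinal kn)) //= ler_wpDr ?sumr_ge0 //.
  have ii' : i <> i' :> nat by move=> /ord_inj eii; rewrite eii eqxx in ii.
  set k := _.-1; have ek : (i = i' + k.+1 :> nat \/ i' = i + k.+1 :> nat)%N.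
    by rewrite /k; move: ii'; clear; lia.
  have -> : `|i%:R - i'%:R| = k.+1%:R :> R.
    case: ek => ->; rewrite natrD; first by rewrite addrC addKr ger0_norm.
    by rewrite opprD addNKr normrN ger0_norm.
  rewrite ler_peMl ?invr_ge0 // -natrD ler1n.
  by case: ek => ->; rewrite eqxx ?addn1 // addnS.
rewrite exchange_big /= mulr_sumr; apply: ler_sum => k _.
rewrite -mulr_suml ler_wpM2r ?invr_ge0 // big_split.
by apply: (lerD (x := _) (y := 1) (z := _) (t := 1));
  apply: sum_atmost1 => x y hx hy; apply: ord_inj; lia.
Qed.

(** The induction step is [1 / (n + 2) <= ln ((n + 2) / (n + 1))], which is [ln (1 + x) <= x] at
    [x = - 1 / (n + 2)]. *)
Lemma harmonic_le_ln (R : realType) (n : nat) : (0 < n)%N ->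
  \sum_(k < n) k.+1%:R^-1 <= 1 + ln n%:R :> R.
Proof.
case: n => // n _; elim: n => [|n IH].
  by rewrite big_ord1 ln1 addr0 invr1.
rewrite big_ord_recr /=; apply: le_trans (lerD IH (lexx _)) _.
rewrite -addrA lerD2l -lerBrDl.
have n1 : 0 < n.+1%:R :> R by rewrite ltr0n.
have n2 : 0 < n.+2%:R :> R by rewrite ltr0n.
have h1 : - 1 < - n.+2%:R^-1 :> R by rewrite ltrN2 invf_lt1 // ltr1n.
have := le_ln1Dx h1; rewrite (_ : 1 - _ = n.+1%:R / n.+2%:R).
  by rewrite ln_div ?posrE // => h; rewrite -lerN2 opprB.
apply: (mulIf (lt0r_neq0 n2)); rewrite mulrBl mul1r mulVf ?divfK ?lt0r_neq0 //.
by rewrite -[n.+2]addn1 natrD addrK.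
Qed.

Lemma nat_dist_ge1 (R : numDomainType) (i j : nat) : i != j -> 1 <= `|i%:R - j%:R| :> R.
Proof.
rewrite neq_ltn => /orP[lt|lt].
  by rewrite distrC ger0_norm ?subr_ge0 ?ler_nat 1?ltnW // -natrB 1?ltnW // ler1n subn_gt0.
by rewrite ger0_norm ?subr_ge0 ?ler_nat 1?ltnW // -natrB 1?ltnW // ler1n subn_gt0.
Qed.

(** * Strips and boxes on the integer grid *)

Section Discretization.
Variables (R : realType) (n : nat) (a : 'I_n -> R) (c delta : R).
Variables (S P : finType) (s : S -> R) (p : P -> R).
Variables (sigma : 'I_n -> 'I_n -> S) (pi : 'I_n -> 'I_n -> P).
Hypotheses (n_gt0 : (0 < n)%N) (c_gt0 : 0 < c) (delta_gt0 : 0 < delta).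
Hypothesis delta_le : delta <= 1 / 2.
Hypothesis a_itv : forall i, 1 <= a i <= 2.
Hypothesis a_gap : forall i i' : 'I_n, c / n%:R * `|i%:R - i'%:R| <= `|a i - a i'|.
Hypothesis s_itv : forall k, 2 <= s k <= 4.
Hypothesis p_itv : forall k, 1 <= p k <= 4.
Hypothesis s_sep : forall k k', k != k' -> delta <= `|s k - s k'|.
Hypothesis p_sep : forall k k', k != k' -> delta <= `|p k - p k'|.
Hypothesis near_s : forall j l, `|a j + a l - s (sigma j l)| < delta.
Hypothesis near_p : forall i l, `|a i * a l - p (pi i l)| < delta.
Hypothesis small_delta : 128 * n%:R * delta <= c.
Hypothesis small_harmonic : n%:R * delta * (\sum_(k < n) k.+1%:R^-1) <= c.

(* Slopes are rounded at scale 1/M, abscissae at scale 1/F and ordinates at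
   scale 1/(M F); bx * by_ is the number of integer points in a delta-box. *)
Variables M F B q bx by_ : nat.
Hypothesis F_gt0 : (0 < F)%N.
Hypothesis F_dvd : forall d, (0 < d <= 2 * M)%N -> (d %| F)%N.
Hypothesis M_delta : 1 <= delta * M%:R.
Hypotheses (B_gt : 16 * delta * M%:R < B%:R) (B_le : B%:R <= 17 * delta * M%:R).
Hypothesis q_gt0 : (0 < q)%N.
Hypothesis q_le : q%:R * (64 * n%:R * delta) <= c.
Hypotheses (bx_le : bx%:R <= delta * F%:R) (by_le : by_%:R <= delta * (M%:R * F%:R)).
Hypothesis area_ge : delta ^+ 2 * M%:R * F%:R ^+ 2 <= 4 * (bx%:R * by_%:R).

Variables (mu : 'I_n -> nat) (off : 'I_n -> 'I_n -> nat).
Hypothesis mu_itv : forall i, M%:R * a i - 1 <= (mu i)%:R <= M%:R * a i.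
Hypothesis off_itv : forall i j,
  M%:R * F%:R * (a i * a j + 6 * delta) - 1 <= (off i j)%:R <=
  M%:R * F%:R * (a i * a j + 6 * delta).

(** [D] is the thin width, [q D] the fat one. Real abscissae are at most [4 + delta < 5], hence [L].
    [Q0] dominates the offsets as well as a slope, at most [2 M], times an abscissa, so [N] has room
    for every fat strip. *)
Let D := (F * B)%N.
Let L := (5 * F)%N.
Let Q0 := (10 * (M * F))%N.
Let N := (2 * Q0 + q * D)%N.
Let m i : int := (mu i)%:Z.
Let cc i j : int := (off i j)%:Z - Q0%:Z.

Let n0 : 0 < n%:R :> R. Proof. by rewrite ltr0n. Qed.

Let aa_itv i j : 1 <= a i * a j <= 4.
Proof. by have := a_itv i; have := a_itv j; nra. Qed.

Let F1 : 1 <= F%:R :> R. Proof. by rewrite ler1n. Qed.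

Let M0 : 0 < M%:R :> R.
Proof. by rewrite -(pmulr_rgt0 _ delta_gt0); apply: lt_le_trans M_delta. Qed.

Let mu_le i : (mu i <= 2 * M)%N.
Proof.
rewrite -(ler_nat R) natrM; have /andP[_ h] := mu_itv i.
have := a_itv i; have := M0; nra.
Qed.

Let off_le i j : (off i j <= Q0)%N.
Proof.
rewrite -(ler_nat R) !natrM; have /andP[_ h] := off_itv i j.
apply: le_trans h _; rewrite mulrC ler_wpM2r ?mulr_ge0 //.
have := aa_itv i j; have := delta_le; lra.
Qed.

Let fit i j : fits L N D q (m i) (cc i j).
Proof.
move=> x xL; have h1 := off_le i j; have h2 := mu_le i.
have h3 : (mu i * x <= 2 * M * (5 * F))%N by rewrite leq_mul // ltnW.
have e : (2 * M * (5 * F) = Q0)%N by rewrite /Q0; ring.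
rewrite /m /cc /N -PoszM; move: h1 h3; rewrite e.
by move: (mu i * x)%N (off i j) (q * D)%N Q0; clear; lia.
Qed.

(** Rounding the slopes costs at most 1, which is at most half of the gap [c M / n]. *)
Let m_gap (i i' : 'I_n) : c * M%:R / (2 * n%:R) * `|i%:R - i'%:R| <= (`|m i - m i'|%N)%:R.
Proof.
rewrite natr_absz intr_norm rmorphB /=.
have -> : (m i)%:~R = (mu i)%:R :> R by [].
have -> : (m i')%:~R = (mu i')%:R :> R by [].
have [->|ii] := eqVneq i i'; first by rewrite !subrr normr0 mulr0.
have h := a_gap i i'.
have d1 : 1 <= `|i%:R - i'%:R| :> R by exact: nat_dist_ge1.
have cn : 2 <= c * M%:R / n%:R.
  rewrite ler_pdivlMr //; have := ler_wpM2r (ler0n R M) small_delta.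
  by have := ler_wpM2l (ltW n0) M_delta; have := n0; lra.
have h2 : M%:R * `|a i - a i'| - 1 <= `|(mu i)%:R - (mu i')%:R|.
  rewrite -{1}(gtr0_norm M0) -normrM mulrBr lerBlDr ler_norml.
  have := ler_norm ((mu i)%:R - (mu i')%:R : R); have := ler_norm (- ((mu i)%:R - (mu i')%:R) : R); rewrite normrN.
  have := mu_itv i; have := mu_itv i'; lra.
apply: le_trans h2; have := ler_wpM2l (ler0n R M) h.
have -> : c * M%:R / (2 * n%:R) = c * M%:R / n%:R / 2 by field; rewrite lt0r_neq0.
have -> : M%:R * (c / n%:R * `|i%:R - i'%:R|) = c * M%:R / n%:R * `|i%:R - i'%:R| by ring.
nra.
Qed.

Let gap0 : 0 < c * M%:R / (2 * n%:R).
Proof. by rewrite divr_gt0 ?mulr_gt0. Qed.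

Let dist_gt0 (i i' : 'I_n) : i' != i -> 0 < `|i%:R - i'%:R| :> R.
Proof. by rewrite eq_sym => ii; apply: lt_le_trans (nat_dist_ge1 R ii). Qed.

Let m_absz_gt0 (i i' : 'I_n) : i' != i -> (0 < `|m i - m i'|)%N.
Proof.
move=> ii; rewrite -(ltr0n R); apply: lt_le_trans (m_gap i i').
by rewrite mulr_gt0 ?dist_gt0.
Qed.

Let m_inj : injective m.
Proof.
move=> i i' mm; apply/eqP/negPn/negP; rewrite eq_sym => /m_absz_gt0.
by rewrite mm subrr.
Qed.

Let m_dvd i i' : i' != i -> (`|m i - m i'|%N %| D)%N.
Proof.
move=> ii; apply: dvdn_mulr; apply: F_dvd; rewrite m_absz_gt0 //=.
have := mu_le i; have := mu_le i'; rewrite /m; clear; lia.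
Qed.

(** As [a i >= 1], the products [a i * a j] keep the gap [c / n] of the [a j]. On the grid the fat
    width is at most [17/64] of this gap by the bound on [q], and the rounding loss 1 is at most
    [1/128] of it. *)
Let cc_sep i j j' : j != j' -> (q * D)%:Z <= `|cc i j - cc i j'|.
Proof.
move=> jj; rewrite -(ler_int R) intr_norm /cc opprB addrA subrK rmorphB /=.
have -> : (q * D)%:~R = q%:R * (F%:R * B%:R) :> R by rewrite /D -pmulrn !natrM.
have -> : (off i j)%:Z%:~R = (off i j)%:R :> R by [].
have -> : (off i j')%:Z%:~R = (off i j')%:R :> R by [].
have MF0 : 0 < M%:R * F%:R :> R by rewrite mulr_gt0 // ltr0n.
have h : M%:R * F%:R * (c / n%:R) - 1 <= `|(off i j)%:R - (off i j')%:R|.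
  have g : c / n%:R <= `|a i * a j - a i * a j'|.
    rewrite -mulrBr normrM; apply: le_trans (_ : `|a j - a j'| <= _).
      apply: le_trans (a_gap j j'); rewrite ler_peMr ?nat_dist_ge1 //.
      by rewrite divr_ge0 // ltW.
    by rewrite ler_peMl // ger0_norm; have := a_itv i; lra.
  apply: le_trans (lerB (ler_wpM2l (ltW MF0) g) (lexx 1)) _.
  rewrite -{1}(gtr0_norm MF0) -normrM mulrBr lerBlDr ler_norml.
  have := ler_norm ((off i j)%:R - (off i j')%:R : R).
  have := ler_norm (- ((off i j)%:R - (off i j')%:R) : R); rewrite normrN.
  have := off_itv i j; have := off_itv i j'; lra.
apply: le_trans h.
have h1 : q%:R * (F%:R * B%:R) <= q%:R * (F%:R * (17 * delta * M%:R)).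
  by rewrite !ler_wpM2l.
have h2 : q%:R * delta * 64 <= c / n%:R by rewrite ler_pdivlMr //; move: q_le; lra.
have h3 : 128 * delta <= c / n%:R by rewrite ler_pdivlMr //; move: small_delta; lra.
have := ler_wpM2l (ltW MF0) h2; have := ler_wpM2l (ltW MF0) h3.
have : 1 <= delta * M%:R * F%:R.
  by apply: le_trans M_delta _; rewrite ler_peMr // mulr_ge0 // ltW.
move: h1; lra.
Qed.

Variables (xs : S -> nat) (ys : P -> nat).
Hypothesis xs_itv : forall k, F%:R * s k < (xs k)%:R <= F%:R * s k + 1.
Hypothesis ys_itv : forall k, M%:R * F%:R * p k < (ys k)%:R <= M%:R * F%:R * p k + 1.

Let box := ((S * P) * ('I_bx * 'I_by_))%type.

Let x_itv k (u : 'I_bx) : F%:R * s k < (xs k + u)%:R <= F%:R * s k + delta * F%:R.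
Proof.
have : (u.+1 <= bx)%N by []; rewrite -(ler_nat R) -natr1 natrD.
have := xs_itv k; have := ler0n R u; move: bx_le; lra.
Qed.

Let y_itv k (v : 'I_by_) : M%:R * F%:R * p k < (ys k + v)%:R <=
  M%:R * F%:R * p k + delta * (M%:R * F%:R).
Proof.
have : (v.+1 <= by_)%N by []; rewrite -(ler_nat R) -natr1 natrD.
have := ys_itv k; have := ler0n R v; move: by_le; lra.
Qed.

Let x_lt k (u : 'I_bx) : (xs k + u < L)%N.
Proof.
rewrite -(ltr_nat R) /L [(5 * F)%:R]natrM; have /andP[_ h] := x_itv k u.
apply: le_lt_trans h _; rewrite mulrC -mulrDl ltr_pM2r ?ltr0n //.
have := s_itv k; move: delta_le; lra.
Qed.

Let y_lt k (v : 'I_by_) : (Q0 + (ys k + v) < N)%N.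
Proof.
rewrite /N mulSn mul1n -addnA ltn_add2l; apply: ltn_addr.
rewrite -(ltr_nat R) /Q0 natrM natrM; have /andP[_ h] := y_itv k v.
apply: le_lt_trans h _; rewrite mulrC -mulrDl ltr_pM2r ?mulr_gt0 // ?ltr0n //.
have := p_itv k; move: delta_le; lra.
Qed.

(* The ordinates are shifted by Q0 so that all strips lie in Y >= 0. *)
Let pt (k : box) : 'I_L * 'I_N :=
  (Ordinal (x_lt k.1.1 k.2.1), Ordinal (y_lt k.1.2 k.2.2)).

Let close (z : R) (e f t t' : R) (e0 : 0 < e) : e * t < z <= e * t + f * e ->
  e * t' < z <= e * t' + f * e -> `|t - t'| < f.
Proof.
move=> h h'; rewrite -(ltr_pM2l e0) -{1}(gtr0_norm e0) -normrM mulrBr ltr_norml; lra.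
Qed.

(** The boxes are half-open of side [delta] with corners [delta]-separated in each coordinate, hence
    disjoint. *)
Let pt_inj : injective pt.
Proof.
move=> [[k k'] [u v]] [[l l'] [w z]] [ex ey].
have F0 : 0 < F%:R :> R by rewrite ltr0n.
have ekl : k = l.
  apply/eqP/negPn/negP => /s_sep; apply/negP; rewrite -ltNge.
  by apply: close F0 (x_itv k u) _; rewrite ex x_itv.
have ekl' : k' = l'.
  apply/eqP/negPn/negP => /p_sep; apply/negP; rewrite -ltNge.
  have MF0 : 0 < M%:R * F%:R :> R by rewrite mulr_gt0.
  by apply: close MF0 (y_itv k' v) _; rewrite (addnI ey) y_itv.
rewrite ekl in ex *; rewrite ekl' in ey *.
by congr (_, (_, _)); apply: ord_inj; [apply: addnI ex | apply: addnI (addnI ey)].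
Qed.

(** Errors in units of [delta * M * F], slopes being at most 2. Downwards: 1 from [near_p], 4 from
    [near_s] and the box width, 1 from rounding [off]; the shift [6 * delta] in [off] compensates
    them. Upwards: 2 + 2, the shift 6, and 5 from rounding slopes at abscissae up to [5 F]; the
    total 15 is below the 16 in [B_gt]. *)
Let pt_on_tube i j l (u : 'I_bx) (v : 'I_by_) :
  ind R D ((pt ((sigma j l, pi i l), (u, v))).2%:Z
    - (m i * (pt ((sigma j l, pi i l), (u, v))).1%:Z - cc i j)) = 1.
Proof.
rewrite /pt /=; set x := (xs _ + u)%N; set y := (ys _ + v)%N.
have [lo hi] : (mu i * x <= y + off i j)%N /\ (y + off i j < mu i * x + D)%N.
  rewrite -(ler_nat R) -(ltr_nat R) /D !(natrD R y) (natrD R (mu i * x)) !natrM.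
  have := x_itv (sigma j l) u; have := y_itv (pi i l) v; rewrite -/x -/y.
  have := near_s j l; have := near_p i l; rewrite !ltr_norml => nP nS yi xi.
  have ai := a_itv i; have mi := mu_itv i; have oi := off_itv i j.
  have F0 : 0 < F%:R :> R by rewrite ltr0n.
  have MF0 : 0 < M%:R * F%:R :> R by rewrite mulr_gt0.
  have Ma0 : 0 < M%:R * a i by rewrite mulr_gt0 //; lra.
  have MaF0 : 0 < M%:R * a i * F%:R by rewrite mulr_gt0.
  have MF1 : 1 <= delta * M%:R * F%:R.
    by apply: le_trans M_delta _; rewrite ler_peMr // mulr_ge0 // ltW.
  have x0 : 0 <= x%:R :> R by [].
  have e1 : M%:R * a i * F%:R * delta <= 2 * (delta * M%:R * F%:R).
    rewrite (_ : M%:R * a i * F%:R * delta = a i * (delta * M%:R * F%:R)); last by ring.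
    by rewrite ler_wpM2r //; lra.
  have xL : x%:R <= 5 * F%:R :> R by rewrite -natrM ler_nat ltnW // x_lt.
  have xL' : 5 * F%:R <= 5 * (delta * M%:R * F%:R).
    by rewrite ler_pM2l // ler_peMl // ltW.
  have p1 : M%:R * F%:R * (a i * a l - delta) <= M%:R * F%:R * p (pi i l).
    by rewrite ler_pM2l //; lra.
  have p2 : M%:R * F%:R * p (pi i l) <= M%:R * F%:R * (a i * a l + delta).
    by rewrite ler_pM2l //; lra.
  have s1 : M%:R * a i * F%:R * (a j + a l - delta) <= M%:R * a i * F%:R * s (sigma j l).
    by rewrite ler_pM2l //; lra.
  have s2 : M%:R * a i * F%:R * s (sigma j l) <= M%:R * a i * F%:R * (a j + a l + delta).
    by rewrite ler_pM2l //; lra.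
  have m1 : (mu i)%:R * x%:R <= M%:R * a i * x%:R by rewrite ler_wpM2r //; lra.
  have m2 : (M%:R * a i - 1) * x%:R <= (mu i)%:R * x%:R by rewrite ler_wpM2r //; lra.
  have m3 : M%:R * a i * x%:R <= M%:R * a i * (F%:R * s (sigma j l) + delta * F%:R).
    by rewrite ler_pM2l //; lra.
  have m4 : M%:R * a i * (F%:R * s (sigma j l)) <= M%:R * a i * x%:R.
    by rewrite ler_pM2l //; lra.
  have b1 : F%:R * (16 * delta * M%:R) < F%:R * B%:R by rewrite ltr_pM2l.
  split; lra.
apply: ind_in; rewrite /m /cc -PoszM; move: lo hi.
by move: (mu i * x)%N (off i j) D Q0; clear; lia.
Qed.

Let incidences : R := \sum_k \sum_i \sum_j
  ind R D ((pt k).2%:Z - (m i * (pt k).1%:Z - cc i j)).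

(** Two sums near the same point differ by less than [2 * delta], which is below the gap [c / n].
    Thus distinct [l] lead a strip to distinct boxes. *)
Let sigma_inj j : injective (sigma j).
Proof.
move=> l l' e; apply/eqP/negPn/negP => ll.
have h : 128 * delta <= c / n%:R by rewrite ler_pdivlMr //; move: small_delta; lra.
have h1 : c / n%:R <= `|a l - a l'|.
  apply: le_trans (a_gap l l'); rewrite ler_peMr ?nat_dist_ge1 //.
  by rewrite divr_ge0 // ltW.
have h2 : `|a l - a l'| < 2 * delta.
  have := near_s j l; have := near_s j l'; rewrite e !ltr_norml.
  by move=> *; lra.
by move: delta_gt0; lra.
Qed.

(** Each of the [n^2] strips contains [n] entire boxes, one for each [l]. *)
Let incidences_ge : n%:R ^+ 3 * (bx%:R * by_%:R) <= incidences.
Proof.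
have -> : n%:R ^+ 3 * (bx%:R * by_%:R) =
    \sum_(i < n) \sum_(j < n) (n * (bx * by_))%:R :> R.
  by rewrite !sumr_const card_ord -mulrnA -mulr_natr !natrM; ring.
rewrite /incidences [leRHS]exchange_big; apply: ler_sum => i _ /=.
rewrite [leRHS]exchange_big; apply: ler_sum => j _ /=.
pose h (t : 'I_n * ('I_bx * 'I_by_)) : box := ((sigma j t.1, pi i t.1), t.2).
have h_inj : injective h by move=> [l w] [l' w'] [] /sigma_inj -> _ ->.
apply: le_trans (sum_inj_le (h := fun k => ind R D _) h_inj _) => [|k]; last exact: ind_ge0.
rewrite (eq_bigr (fun _ => 1)) => [|[l [u v]] _]; last exact: pt_on_tube.
by rewrite sumr_const !card_prod !card_ord.
Qed.

Let inv_gap_sum : \sum_i \sum_(i' | i' != i) (`|m i - m i'|%N)%:R^-1 <=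
  4 * n%:R ^+ 2 * (\sum_(k < n) k.+1%:R^-1) / (c * M%:R).
Proof.
apply: le_trans (_ : \sum_(i < n) \sum_(i' < n | i' != i)
    (c * M%:R / (2 * n%:R))^-1 * `|i%:R - i'%:R|^-1 <= _).
  apply: ler_sum => i _; apply: ler_sum => i' ii.
  rewrite -invfM lef_pV2 ?posrE; first exact: m_gap.
    by rewrite ltr0n m_absz_gt0.
  by rewrite mulr_gt0 ?dist_gt0 // eq_sym.
under eq_bigr do rewrite -mulr_sumr.
rewrite -mulr_sumr; apply: le_trans (ler_wpM2l _ (sum_inv_dist_le R n)) _.
  by rewrite invr_ge0 ltW.
rewrite le_eqVlt; apply/orP; left; apply/eqP; field.
by rewrite !lt0r_neq0.
Qed.

(** If the fat strips may account for more than half of the weighted incidences, comparison with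
    [incidences_ge] gives the first alternative; otherwise [incidence_bound] gives the second. *)
Lemma discretized_dichotomy : q%:R * n%:R ^+ 2 <= 2 * (#|S| * #|P|)%:R :> R \/
  n%:R ^+ 4 * delta <= 16 * 17 * 554 * (#|S| * #|P|)%:R.
Proof.
set X : R := (#|S| * #|P|)%:R; set beta : R := bx%:R * by_%:R.
have F0 : 0 < F%:R :> R by rewrite ltr0n.
have A0 : 0 < delta * M%:R * F%:R ^+ 2 by rewrite !mulr_gt0 ?exprn_gt0.
have beta0 : 0 < beta.
  rewrite -(ltr_pM2l (ltr0n R 4)) mulr0; apply: lt_le_trans area_ge.
  by rewrite !mulr_gt0 ?exprn_gt0.
have q0 : 0 < q%:R :> R by rewrite ltr0n.
have cardK : #|{: box}|%:R = X * beta by rewrite !card_prod !card_ord natrM [(bx * by_)%:R]natrM.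
have incq : q%:R * (n%:R ^+ 3 * beta) <= q%:R * incidences by rewrite ler_pM2l.
have := @incidence_bound R L N D q q_gt0 _ _ m cc fit m_inj m_dvd cc_sep box pt pt_inj.
rewrite -/incidences cardK card_ord => bound.
case: (lerP (2 * n%:R * (X * beta)) (q%:R * incidences)) => [{}/bound bound|small]; [right|left]; last first.
  have nb : 0 < n%:R * beta by rewrite mulr_gt0.
  by rewrite -(ler_pM2r nb); lra.
(* Cut crossings cost [8 * 4 * 17 = 544] once [small_harmonic] absorbs the harmonic sum; the
   diagonal adds [2 * 5 = 10], for a total of 554. *)
have V1 : 8 * n%:R * (q * D)%:R ^+ 2 * (\sum_i \sum_(i' | i' != i) (`|m i - m i'|%N)%:R^-1)
    <= 544 * n%:R ^+ 2 * q%:R ^+ 2 * (D%:R * F%:R) :> R.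
  apply: le_trans (ler_wpM2l _ inv_gap_sum) _; first by rewrite !mulr_ge0 ?exprn_ge0.
  have hH := small_harmonic; set H := \sum_(k < n) _ in hH *.
  have H0 : 0 <= H by apply: sumr_ge0 => k _; rewrite invr_ge0.
  rewrite [leLHS](_ : _ = 32 * n%:R ^+ 2 * q%:R ^+ 2 * (D%:R * F%:R) * (B%:R * (n%:R * H) / (c * M%:R))).
    rewrite [leRHS](_ : _ = 32 * n%:R ^+ 2 * q%:R ^+ 2 * (D%:R * F%:R) * 17); last by ring.
    rewrite ler_wpM2l ?mulr_ge0 ?exprn_ge0 // ler_pdivrMr ?mulr_gt0 //.
    apply: le_trans (ler_wpM2r _ B_le) _; first by rewrite mulr_ge0.
    have := ler_wpM2l (ler0n R M) hH; lra.
  by rewrite [(q * D)%:R]natrM {1}/D [(F * B)%:R]natrM; field; rewrite !lt0r_neq0.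
have D_le : D%:R <= 17 * (delta * M%:R * F%:R).
  rewrite /D natrM; apply: le_trans (ler_wpM2l (ltW F0) B_le) _; lra.
have V2 : n%:R * n%:R * (2 * q%:R ^+ 2 * D%:R * L%:R) +
    8 * n%:R * (q * D)%:R ^+ 2 * (\sum_i \sum_(i' | i' != i) (`|m i - m i'|%N)%:R^-1)
    <= 17 * 554 * n%:R ^+ 2 * q%:R ^+ 2 * (delta * M%:R * F%:R ^+ 2) :> R.
  apply: le_trans (lerD (lexx _) V1) _.
  rewrite [L%:R]natrM (_ : _ + _ = 554 * n%:R ^+ 2 * q%:R ^+ 2 * F%:R * D%:R); last by ring.
  apply: le_trans (ler_wpM2l _ D_le) _; first by rewrite !mulr_ge0 ?exprn_ge0.
  by rewrite le_eqVlt; apply/orP; left; apply/eqP; ring.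
have X0 : 0 <= X by [].
have b0 : 0 <= beta by exact: ltW.
have inc0 : 0 <= incidences by apply: le_trans incidences_ge; rewrite mulr_ge0 ?exprn_ge0.
have key : (q%:R * (n%:R ^+ 3 * beta)) ^+ 2 <=
    4 * (X * beta) * (17 * 554 * n%:R ^+ 2 * q%:R ^+ 2 * (delta * M%:R * F%:R ^+ 2)).
  apply: le_trans (_ : (q%:R * incidences) ^+ 2 <= _).
    by rewrite ler_sqr // nnegrE ?mulr_ge0 ?exprn_ge0.
  by apply: le_trans bound _; rewrite ler_wpM2l ?mulr_ge0.
have c0 : 0 < n%:R ^+ 2 * q%:R ^+ 2 * beta by rewrite mulr_gt0 // mulr_gt0 ?exprn_gt0.
have key2 : n%:R ^+ 4 * beta <= 4 * 17 * 554 * X * (delta * M%:R * F%:R ^+ 2).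
  by rewrite -(ler_pM2l c0); lra.
rewrite -(ler_pM2r A0); have := ler_wpM2l (exprn_ge0 4 (ltW n0)) area_ge.
rewrite -/beta; lra.
Qed.

End Discretization.

(** * Separated sets of reals and the choice of the grid *)

Section SumProduct.
Variable R : realType.
Implicit Types (A B S : {fset R}) (r : R).

(** A separated subset of largest size is also a net: a point at distance at least [r] from all its
    elements could be added. *)
Lemma maximal_separated B r : 0 < r -> exists S, [/\ (S `<=` B)%fset, dist_separated r S,
  (#|` S| <= sepnum B r)%N & forall x, x \in B -> exists2 y, y \in S & `|x - y| < r].
Proof.
move=> r0; pose Q k := `[< exists S, [/\ (S `<=` B)%fset, dist_separated r S & #|` S| = k] >].
have exQ : exists k, Q k by exists 0%N; apply/asboolP; exists fset0; split.
have ubQ k : Q k -> (k <= #|` B|)%N by move=> /asboolP[S [SB _ <-]]; apply: fsubset_leq_card.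
case: (ex_maxnP exQ ubQ) => k /asboolP[S [SB sepS <-]] maxS; exists S; split => //.
  by apply: (@leq_bigmax_seq _ _ _ (fun S => #|` S|)); [rewrite fpowersetE | apply/asboolP].
move=> x xB; apply: contrapT => far.
have farS y : y \in S -> r <= `|x - y|.
  by move=> yS; rewrite leNgt; apply/negP => xy; apply: far; exists y.
have xS : x \notin S by apply/negP => /farS; rewrite subrr normr0 leNgt r0.
have : (#|` x |` S|%fset <= #|` S|)%N.
  apply: maxS; apply/asboolP; exists (x |` S)%fset; split => //.
    by rewrite fsubUset fsub1set xB.
  move=> y z /fset1UP[->|yS] /fset1UP[->|zS]; rewrite ?eqxx //.
  - by move=> _; apply: farS.
  - by move=> _; rewrite distrC; apply: farS.
  - exact: sepS.
by rewrite cardfsU1 xS add1n ltnn.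
Qed.

(** In increasing order, consecutive gaps of at least [r] add up. *)
Lemma separated_enumeration A r : 0 < r -> dist_separated r A ->
  exists a : 'I_#|` A| -> R, (forall i, a i \in A) /\
    forall i i' : 'I_#|` A|, r * `|i%:R - i'%:R| <= `|a i - a i'|.
Proof.
move=> r0 sepA; set s := sort <=%R (enum_fset A).
have sz : size s = #|` A| by rewrite size_sort.
have sA i : (i < #|` A|)%N -> nth 0 s i \in A.
  by rewrite -sz => /(mem_nth 0); rewrite mem_sort.
have ss : sorted <=%R s by exact/sort_sorted/le_total.
have us : uniq s by rewrite sort_uniq fset_uniq.
have gap i k : (i + k < #|` A|)%N -> r * k%:R <= nth 0 s (i + k) - nth 0 s i.
  elim: k => [|k IH] ik; first by rewrite addn0 subrr mulr0.
  have ik' : (i + k < #|` A|)%N by apply: leq_trans ik; rewrite addnS.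
  have le1 : nth 0 s (i + k) <= nth 0 s (i + k.+1).
    by apply: (sorted_leq_nth le_trans lexx 0 ss); rewrite ?inE ?sz // leq_add2l.
  have ne : nth 0 s (i + k.+1) != nth 0 s (i + k).
    by rewrite nth_uniq ?sz // eqn_add2l gtn_eqF.
  have := sepA _ _ (sA _ ik) (sA _ ik') ne; rewrite ger0_norm ?subr_ge0 //.
  have := IH ik'; rewrite -natr1; lra.
exists (fun i => nth 0 s i); split => [i|i i']; first exact: sA.
wlog ii : i i' / (i' <= i)%N => [hw|].
  by case/orP: (leq_total i' i) => /hw // h; rewrite distrC [leRHS]distrC.
have := gap i' (i - i')%N; rewrite subnKC // => /(_ (ltn_ord i)).
rewrite natrB // [in X in X -> _]/= => h; rewrite [X in _ * X]ger0_norm ?subr_ge0 ?ler_nat //.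
by apply: le_trans h (ler_norm _).
Qed.

Lemma truncn_ge_half (x : R) : 1 <= x -> x <= 2 * (Num.truncn x)%:R.
Proof.
move=> x1; have := truncnS_gt x; rewrite -natr1.
have : 1 <= (Num.truncn x)%:R :> R by rewrite ler1n truncn_gt0.
lra.
Qed.

Lemma truncn_bounds (x : R) : 0 <= x -> x - 1 <= (Num.truncn x)%:R <= x.
Proof. by move=> /truncn_itv/andP[-> ]; rewrite -natr1 andbT => /ltW; lra. Qed.

Lemma sum_product_dichotomy (A : {fset R}) (c delta : R) : A != fset0 ->
  (forall a : R, a \in A -> 1 <= a <= 2) -> dist_separated (c * (#|` A|%:R)^-1) A ->
  0 < c -> 0 < delta -> delta <= 1 / 2 -> 128 * #|` A|%:R * delta <= c ->
  #|` A|%:R * delta * (\sum_(k < #|` A|) k.+1%:R^-1) <= c ->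
  c * #|` A|%:R <= 256 * (sepnum (sumset A) delta * sepnum (prodset A) delta)%:R * delta \/
  #|` A|%:R ^+ 4 * delta <=
    16 * 17 * 554 * (sepnum (sumset A) delta * sepnum (prodset A) delta)%:R.
Proof.
move=> A0 A12 sepA c0 d0 dle small harm; set n := #|` A| in sepA small harm *.
have n0 : (0 < n)%N by rewrite cardfs_gt0.
have nR : 0 < n%:R :> R by rewrite ltr0n.
have [a [aA a_gap]] := separated_enumeration (divr_gt0 c0 nR) sepA.
have a12 i : 1 <= a i <= 2 by exact: A12.
have [S [SB sepS cardS nearS]] := maximal_separated (sumset A) d0.
have [P [PB sepP cardP nearP]] := maximal_separated (prodset A) d0.
have hS (t : 'I_n * 'I_n) : exists k : S, `|a t.1 + a t.2 - val k| < delta.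
  have [y yS h] := nearS (a t.1 + a t.2) (in_imfset2 _ _ (aA _) (aA _)).
  by exists [` yS]%fset.
have hP (t : 'I_n * 'I_n) : exists k : P, `|a t.1 * a t.2 - val k| < delta.
  have [y yP h] := nearP (a t.1 * a t.2) (in_imfset2 _ _ (aA _) (aA _)).
  by exists [` yP]%fset.
have [sigma near_s] := boolp.choice hS; have [pi near_p] := boolp.choice hP.
have s24 (k : S) : 2 <= val k <= 4.
  have /(fsubsetP SB)/imfset2P[x /= /A12 hx [y /= /A12 hy ->]] := valP k; lra.
have p14 (k : P) : 1 <= val k <= 4.
  have /(fsubsetP PB)/imfset2P[x /= /A12 hx [y /= /A12 hy ->]] := valP k; nra.
(* [M] is just above [1 / delta], so rounding changes a slope by at most [delta]; the factorial is
   divisible by every slope difference, these being at most [2 * M]. *)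
pose M := (Num.truncn delta^-1).+1; pose F := (2 * M)`!.
have M_delta : 1 <= delta * M%:R.
  have := truncnS_gt delta^-1; rewrite -/M => /ltW h.
  by rewrite -[leLHS](divff (lt0r_neq0 d0)) ler_pM2l.
have MR : 0 < M%:R :> R by rewrite ltr0n.
have FR : 0 < F%:R :> R by rewrite ltr0n fact_gt0.
have F_delta : 1 <= delta * F%:R.
  apply: le_trans M_delta _; rewrite ler_pM2l // ler_nat.
  by apply: leq_trans (fact_geq _); rewrite leq_pmull.
have MF_delta : 1 <= delta * (M%:R * F%:R).
  by apply: le_trans M_delta _; rewrite ler_pM2l // ler_peMr ?ler1n ?fact_gt0 ?ler0n.
have dM0 : 0 <= 16 * delta * M%:R by rewrite !mulr_ge0 // ltW.
have nd0 : 0 < 64 * n%:R * delta by rewrite !mulr_gt0.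
(* The fat width [q * delta] becomes comparable to [c / n]. The quotient is at least 1, so
   truncation loses at most a factor 2. *)
pose q := Num.truncn (c / (64 * n%:R * delta)).
have q0 : 0 <= c / (64 * n%:R * delta) by rewrite divr_ge0 // ltW.
have q1 : 1 <= c / (64 * n%:R * delta) by rewrite ler_pdivlMr // mul1r; lra.
have q_le : q%:R * (64 * n%:R * delta) <= c.
  by rewrite -ler_pdivlMr //; case/andP: (truncn_itv q0).
have q_ge : c <= q%:R * (128 * n%:R * delta).
  by have := truncn_ge_half q1; rewrite -/q ler_pdivrMr //; lra.
have area : delta ^+ 2 * M%:R * F%:R ^+ 2 <=
    4 * ((Num.truncn (delta * F%:R))%:R * (Num.truncn (delta * (M%:R * F%:R)))%:R).
  have := ler_pM _ _ (truncn_ge_half F_delta) (truncn_ge_half MF_delta).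
  rewrite (_ : delta ^+ 2 * _ * _ = delta * F%:R * (delta * (M%:R * F%:R))); last by ring.
  rewrite (_ : 4 * _ = 2 * (Num.truncn (delta * F%:R))%:R *
    (2 * (Num.truncn (delta * (M%:R * F%:R)))%:R)); last by ring.
  by apply; [apply: le_trans F_delta | apply: le_trans MF_delta].
have XS : (#|{: S}| * #|{: P}|)%:R <=
    (sepnum (sumset A) delta * sepnum (prodset A) delta)%:R :> R.
  by rewrite ler_nat leq_mul // -cardfE.
have dich : q%:R * n%:R ^+ 2 <= 2 * (#|{: S}| * #|{: P}|)%:R :> R \/
    n%:R ^+ 4 * delta <= 16 * 17 * 554 * (#|{: S}| * #|{: P}|)%:R.
  apply: (@discretized_dichotomy R n a c delta S P val val (fun i j => sigma (i, j))
    (fun i j => pi (i, j)) n0 c0 d0 dle a12 a_gap s24 p14 _ _ _ _ small harm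
    M F (Num.truncn (16 * delta * M%:R)).+1 q (Num.truncn (delta * F%:R))
    (Num.truncn (delta * (M%:R * F%:R))) _ _ M_delta _ _ _ q_le _ _ area
    (fun i => Num.truncn (M%:R * a i))
    (fun i j => Num.truncn (M%:R * F%:R * (a i * a j + 6 * delta))) _ _
    (fun k => (Num.truncn (F%:R * val k)).+1) (fun k => (Num.truncn (M%:R * F%:R * val k)).+1)).
  - by move=> k k' kk; apply: sepS => //; apply: valP.
  - by move=> k k' kk; apply: sepP => //; apply: valP.
  - by move=> j l; apply: (near_s (j, l)).
  - by move=> i l; apply: (near_p (i, l)).
  - exact: fact_gt0.
  - by move=> d; apply: dvdn_fact.
  - exact: truncnS_gt.
  - by have := truncn_bounds dM0; rewrite -natr1; lra.
  - by rewrite truncn_gt0.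
  - by rewrite truncn_le; apply: le_trans F_delta.
  - by rewrite truncn_le; apply: le_trans MF_delta.
  - by move=> i; apply: truncn_bounds; rewrite mulr_ge0 //; have := a12 i; lra.
  - move=> i j; apply: truncn_bounds; rewrite !mulr_ge0 //.
    by have := a12 i; have := a12 j; nra.
  - move=> k; rewrite truncnS_gt -natr1 lerD2r truncn_le mulr_ge0 //.
    by have := s24 k; lra.
  - move=> k; rewrite truncnS_gt -natr1 lerD2r truncn_le !mulr_ge0 //.
    by have := p14 k; lra.
case: dich => h; [left|right]; last first.
  by move: h XS; lra.
set X := (sepnum _ _ * _)%:R in XS *.
have h2 : q%:R * n%:R ^+ 2 <= 2 * X by apply: le_trans h _; rewrite ler_wpM2l.
have nd : 0 < 128 * delta by rewrite mulr_gt0.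
(* Since [q >= c / (128 n delta)], the bound [q n^2 <= 2 X] turns into [c n <= 256 X delta]. *)
have := ler_wpM2r (ltW nR) q_ge; have := ler_wpM2l (ltW nd) h2; lra.
Qed.

End SumProduct.

(** * Choice of the constants and conclusion *)

Lemma sepnum_gt0 (R : realType) (B : {fset R}) (r x : R) :
  0 < r -> x \in B -> (0 < sepnum B r)%N.
Proof.
move=> r0 xB; have [S [_ _ cardS near]] := maximal_separated B r0.
have [y yS _] := near x xB; apply: leq_trans cardS.
by rewrite cardfs_gt0; apply/fset0Pn; exists y.
Qed.

Lemma sum_product_lower_bound (R : realType) (alpha c : R) : 1 < alpha <= 3 / 2 -> 0 < c ->
  exists2 K : R, 0 < K & forall A : {fset R}, A != fset0 ->
    (forall a : R, a \in A -> 1 <= a <= 2) -> dist_separated (c * (#|` A|%:R)^-1) A ->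
    #|` A|%:R `^ (1 + alpha) <= K *
      (sepnum (sumset A) (#|` A|%:R `^ (- alpha)) *
       sepnum (prodset A) (#|` A|%:R `^ (- alpha)))%:R.
Proof.
(* With this exponent, [y = n^b] satisfies [n delta y^2 = 1]: in the harmonic condition one factor
   [y] beats the logarithm, the other the constants. *)
move=> /andP[a1 a2] c0; pose b := (alpha - 1) / 2.
have b0 : 0 < b by rewrite divr_gt0 // subr_gt0.
(* The summands yield in turn [y >= 2], the harmonic condition and [128 n delta <= c] as soon as
   [y >= T]. *)
pose T := 2 + (1 + b^-1) / c + 128 / c.
have T0 : 0 <= T by rewrite !addr_ge0 ?divr_ge0 ?addr_ge0 ?invr_ge0 // ltW.
have K1 : 0 <= T `^ ((1 + alpha) / b) by exact: powR_ge0.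
have [k [k0 kE]] : exists k : R, 0 < k /\ 16 * 17 * 554 = k.
  by exists (16 * 17 * 554); split; [lra | exact: erefl].
have c1 : 0 < 256 / c by rewrite divr_gt0 ?ltr0n.
exists (256 / c + k + T `^ ((1 + alpha) / b)) => [|A A0 A12 sepA].
  by move: (T `^ _) K1 => Tp K1; lra.
set n := #|` A|; set delta := _ `^ (- alpha).
have n0 : (0 < n)%N by rewrite cardfs_gt0.
have nR : 0 < n%:R :> R by rewrite ltr0n.
have n1 : 1 <= n%:R :> R by rewrite ler1n.
have nz : n%:R != 0 :> R by rewrite gt_eqF.
have d0 : 0 < delta by rewrite powR_gt0.
set X := (_ * _)%:R; have X1 : 1 <= X :> R.
  rewrite ler1n muln_gt0; have /fset0Pn[x xA] := A0.
  by rewrite !(sepnum_gt0 (x := _) d0 (in_imfset2 _ _ xA xA)).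
have X0 : 0 <= X by apply: le_trans X1.
set z := n%:R `^ (1 + alpha); set y := n%:R `^ b.
(* For [y < T] the left side is bounded by a constant, and [X >= 1] suffices. *)
case: (lerP T y) => [Ty|yT]; last first.
  have zT : z <= T `^ ((1 + alpha) / b).
    have -> : z = y `^ ((1 + alpha) / b).
      by rewrite /y -powRrM mulrCA divff ?mulr1 // gt_eqF.
    apply: ge0_ler_powR; rewrite ?nnegrE ?powR_ge0 ?(ltW yT) //.
    by rewrite divr_ge0 ?(ltW b0) //; lra.
  apply: le_trans zT _; apply: le_trans (_ : T `^ ((1 + alpha) / b) * X <= _).
    by rewrite ler_peMr.
  by apply: (ler_wpM2r X0); rewrite lerDr ltW // addr_gt0.
have nd : n%:R * delta * y ^+ 2 = 1.
  rewrite -(powR_mulrn 2 (powR_ge0 _ _)) /y -powRrM /delta.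
  rewrite -{1}(powRr1 (ltW nR)) -powRD ?nz ?implybT // -powRD ?nz ?implybT //.
  by rewrite (_ : 1 + _ + _ = 0) ?powRr0 // /b; field.
have zd : z * delta = n%:R.
  by rewrite -powRD ?nz ?implybT // addrK powRr1 // ltW.
have cT : c * T = 2 * c + (1 + b^-1) + 128 by rewrite /T; field; rewrite ?gt_eqF.
have cy : 2 * c + (1 + b^-1) + 128 <= c * y by rewrite -cT ler_pM2l.
have bi0 : 0 < b^-1 by rewrite invr_gt0.
have y2 : 2 <= y by rewrite -(ler_pM2l c0); lra.
have nd0 : 0 < n%:R * delta by rewrite mulr_gt0.
have ndy : n%:R * delta * y <= 1 / 2.
  have := nd; rewrite expr2 mulrA => e.
  have : n%:R * delta * y * 2 <= 1.
    by rewrite -[leRHS]e; apply: ler_wpM2l y2; rewrite mulr_ge0 ?(ltW nd0) ?powR_ge0.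
  lra.
have dle : delta <= 1 / 2.
  apply: le_trans ndy; rewrite -mulrA mulrCA ler_peMr ?(ltW d0) //.
  by rewrite -[1]mulr1 ler_pM //; lra.
have small : 128 * n%:R * delta <= c.
  have h : n%:R * delta * 128 <= n%:R * delta * (c * y) by rewrite ler_wpM2l ?(ltW nd0) //; lra.
  have := ler_wpM2l (ltW c0) ndy; lra.
have lny : ln n%:R <= b^-1 * y.
  have : ln y <= y by apply/ltW/ln_sublinear; rewrite powR_gt0.
  by rewrite /y ln_powR -/y mulrC -ler_pdivlMr // mulrC.
have harm : n%:R * delta * (\sum_(k < n) k.+1%:R^-1) <= c.
  apply: le_trans (ler_wpM2l (ltW nd0) (harmonic_le_ln R n0)) _.
  have h1 : 1 + ln n%:R <= (c * y) * y.
    apply: le_trans (_ : (1 + b^-1) * y <= _); first by lra.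
    by rewrite ler_wpM2r //; lra.
  apply: le_trans (ler_wpM2l (ltW nd0) h1) _.
  have -> : n%:R * delta * (c * y * y) = c * (n%:R * delta * y ^+ 2) by ring.
  by rewrite nd mulr1.
case: (sum_product_dichotomy A0 A12 sepA c0 d0 dle small harm); rewrite -/n -/X ?kE => h.
  apply: le_trans (_ : 256 / c * X <= _); last first.
    by apply: (ler_wpM2r X0); rewrite -addrA lerDl addr_ge0 // ltW.
  rewrite -(ler_pM2r d0) zd -(ler_pM2l c0); apply: le_trans h _.
  by rewrite le_eqVlt; apply/orP; left; apply/eqP; field; rewrite gt_eqF.
apply: le_trans (_ : k * X <= _); last first.
  by apply: (ler_wpM2r X0); rewrite addrAC lerDr addr_ge0 // ltW.
(* Here [alpha <= 3/2] enters as [1 + alpha <= 4 - alpha]. *)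
apply: le_trans h; have -> : n%:R ^+ 4 * delta = n%:R `^ (4 - alpha).
  by rewrite powRD ?nz ?implybT // powR_mulrn // ltW.
by rewrite ler_powR //; lra.
Qed.

Theorem theorem1 (R : realType) (alpha c : R)
    (halpha : 1 < alpha <= 3 / 2) (hc : 0 < c) (eps : R) (heps : 0 < eps) :
  exists C1 C2 : R, [/\ 0 < C1, 0 < C2 &
    forall A : {fset R},
      A != fset0 ->
      (forall a : R, a \in A -> 1 <= a <= 2) ->
      dist_separated (c * (#|` A|%:R)^-1) A ->
      let n : R := #|` A|%:R in
      let delta : R := n `^ (- alpha) in
      let eps' : R := eps * alpha in
      let NS : nat := sepnum (sumset A) delta in
      let NP : nat := sepnum (prodset A) delta in
      [/\ C1^-1 * (n * delta `^ (- 1 + eps)) <= NS%:R * NP%:R,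
          n * delta `^ (- 1 + eps) = n `^ (1 + alpha - eps'),
          C2^-1 * (delta `^ (- (1 / 2) + eps) * n `^ (1 / 2))
            <= (maxn NS NP)%:R
        & delta `^ (- (1 / 2) + eps) * n `^ (1 / 2)
            = n `^ ((1 + alpha) / 2 - eps')]].
Proof.
have [K K0 bound] := sum_product_lower_bound halpha hc.
(* The square of the maximum is at least the product, whence the square root of [K]. *)
exists K, (Num.sqrt K); split; rewrite ?sqrtr_gt0 // => A A0 A12 sepA n delta eps' NS NP.
have n1 : 1 <= n by rewrite ler1n cardfs_gt0.
have n0 : 0 < n by apply: lt_le_trans n1.
have nz : n != 0 by rewrite gt_eqF.
have e'0 : 0 < eps' by rewrite mulr_gt0 //; move: halpha; lra.
have E1 : n * delta `^ (- 1 + eps) = n `^ (1 + alpha - eps').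
  rewrite -powRrM -{1}(powRr1 (ltW n0)) -powRD ?nz ?implybT //.
  by congr (_ `^ _); rewrite /eps'; ring.
have E2 : delta `^ (- (1 / 2) + eps) * n `^ (1 / 2) = n `^ ((1 + alpha) / 2 - eps').
  rewrite -powRrM -powRD ?nz ?implybT //.
  by congr (_ `^ _); rewrite /eps'; field.
have {}bound : n `^ (1 + alpha) <= K * (NS * NP)%:R by exact: bound.
split => //.
  (* As [n >= 1] and [eps' > 0], lowering the exponent by [eps'] only weakens the bound. *)
  rewrite E1 ler_pdivrMl // -natrM; apply: le_trans bound.
  by rewrite ler_powR //; lra.
rewrite E2 ler_pdivrMl ?sqrtr_gt0 //.
apply: le_trans (_ : n `^ ((1 + alpha) / 2) <= _); first by rewrite ler_powR //; lra.
rewrite -ler_sqr ?nnegrE ?powR_ge0 ?mulr_ge0 ?sqrtr_ge0 //.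
rewrite -powR_mulrn ?powR_ge0 // -powRrM divfK ?pnatr_eq0 // exprMn sqr_sqrtr ?(ltW K0) //.
apply: le_trans bound _; rewrite ler_pM2l // -natrX ler_nat.
by rewrite leq_mul ?leq_maxl ?leq_maxr.
Qed.
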